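(* Let $(\mathfrak a,\omega_{\mathfrak a})$ be a restricted orthosymplectic quasi-Frobenius Lie superalgebra, let $\mathscr D\in\mathfrak{der}^p_{\bar 0}(\mathfrak a)$ be an even restricted derivation satisfying the $p$-property, with $\gamma\in\mathbb K$, $a_0\in\mathfrak a_{\bar 0}$ such that $\mathscr D^p=\gamma\mathscr D+\mathrm{ad}_{a_0}$ and $\mathscr D(a_0)=0$, and let $\lambda\in\mathbb K$. Let $C$, $P$, $\Omega$, $T$ be the maps defined in the context (with $\Omega$, $T$ depending on $\lambda$, and $P$ a map satisfying the two conditions given there). Suppose that $T$ has the $*$-property with respect to $\Omega$ and that $$(\Omega,T)\in B^2_*(\mathfrak a;\mathbb K)\qquad\text{and}\qquad (C,P)\in Z^2_*(\mathfrak a;\mathbb K).$$ Let $Z_\Omega\in\mathfrak a_{\bar 0}$ be such that $\Omega(a,b)=\omega_{\mathfrak a}(Z_\Omega,[a,b]_{\mathfrak a})$ for all $a,b\in\mathfrak a$ and $T(a)=\omega_{\mathfrak a}(Z_\Omega,a^{[p]})$ for all $a\in\mathfrak a_{\bar 0}$. (i) Let $\mathscr K=\mathrm{Span}\{x\}$ and $\mathscr K^*=\mathrm{Span}\{x^*\}$ with $x,x^*$ even. There is a Lie superalgebra structure on $\mathfrak g:=\mathscr K\oplus\mathfrak a\oplus\mathscr K^*$ given, for all $a,b\in\mathfrak a$, by $$[x,x^*]_{\mathfrak g}=\lambda x,\qquad [a,b]_{\mathfrak g}=[a,b]_{\mathfrak a}+\omega_{\mathfrak a}(\mathscr D(a)+\mathscr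 D^*(a),b)\,x,\qquad [x^*,a]_{\mathfrak g}=\mathscr D(a)+\omega_{\mathfrak a}(Z_\Omega,a)\,x$$ (and $[x,a]_{\mathfrak g}=0$). There is a closed anti-symmetric orthosymplectic form $\omega_{\mathfrak g}$ on $\mathfrak g$ given by $$\omega_{\mathfrak g}|_{\mathfrak a\times\mathfrak a}=\omega_{\mathfrak a},\quad \omega_{\mathfrak g}(\mathfrak a,\mathscr K)=\omega_{\mathfrak g}(\mathfrak a,\mathscr K^* )=0,\quad \omega_{\mathfrak g}(x^*,x)=1,\quad \omega_{\mathfrak g}(x,x)=\omega_{\mathfrak g}(x^*,x^* )=0.$$ (ii) There is a $p|2p$-map on $\mathfrak g$ given by $$a^{[p]_{\mathfrak g}}=a^{[p]_{\mathfrak a}}+P(a)x\ \ (a\in\mathfrak a_{\bar 0}),\qquad (x^* )^{[p]_{\mathfrak g}}=\gamma x^*+a_0+\tilde\lambda x,\qquad x^{[p]_{\mathfrak g}}=b_0+\sigma x+\delta x^*,$$ where $b_0\in\mathfrak a_{\bar 0}$, $\tilde\lambda,\sigma,\delta\in\mathbb K$ and the following hold. (a) If $\lambda\neq 0$: $\mathscr D(a_0)=0$, $\tilde\lambda=\frac1\lambda\omega_{\mathfrak a}(Z_\Omega,a_0)$, $\gamma=\lambda^{p-1}$, $\delta=0$, $\mathscr D(b_0)=0$, $\sigma=\frac1\lambda\omega_{\mathfrak a}(Z_\Omega,b_0)$, $\mathscr D^*(b_0)=0$, $b_0\in\mathfrak z(\mathfrak a)$, and $$\mathscr D^*(a_0)=\sum_{1\le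 i\le p-1}(-1)^{p-1-i}\lambda^{p-1-i}(\mathscr D^* )^i(Z_\Omega).$$ (b) If $\lambda=0$ and $\mathscr D$ is not of the form $-\delta^{-1}\mathrm{ad}_{b_0}$ of case (c): $\mathscr D(a_0)=0$, $\omega_{\mathfrak a}(Z_\Omega,a_0)=0$, $\delta=0$, $\mathscr D(b_0)=0$, $\omega_{\mathfrak a}(Z_\Omega,b_0)=0$, $\mathscr D^*(b_0)=0$, $b_0\in\mathfrak z(\mathfrak a)$, and $$\mathscr D^*(a_0)+\gamma Z_\Omega=(\mathscr D^* )^{p-1}(Z_\Omega).$$ (c) If $\lambda=0$ and $\mathscr D=-\delta^{-1}\mathrm{ad}_{b_0}$ (with $\delta\ne0$) is inner: $\mathscr D(a_0)=0$, $\omega_{\mathfrak a}(Z_\Omega,a_0)=0$, $\mathscr D(b_0)=0$, $\omega_{\mathfrak a}(Z_\Omega,b_0)=0$, $\mathscr D^*(b_0)=-\delta Z_\Omega$, and $$\mathscr D^*(a_0)+\gamma Z_\Omega=(\mathscr D^* )^{p-1}(Z_\Omega).$$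
   Context: $\mathbb K$ is a field of characteristic $p>2$. Lie superalgebras $\mathfrak a=\mathfrak a_{\bar 0}\oplus\mathfrak a_{\bar 1}$ are finite-dimensional over $\mathbb K$; $[u,[u,u]]=0$ for odd $u$ is part of the definition (needed if $p=3$). $|u|$ is the parity of $u$; formulas with parities are for homogeneous elements. $\mathfrak z(\mathfrak a)$ is the center. A $p$-structure on a Lie algebra $L$ is a map $a\mapsto a^{[p]}$ with $\mathrm{ad}_{a^{[p]}}=(\mathrm{ad}_a)^p$, $(\alpha a)^{[p]}=\alpha^pa^{[p]}$, $(a+b)^{[p]}=a^{[p]}+b^{[p]}+\sum_{i=1}^{p-1}s_i(a,b)$, where $(\mathrm{ad}_{\mu a+b})^{p-1}(a)=\sum_{i=1}^{p-1}i\,s_i(a,b)\mu^{i-1}$. A $p|2p$-map on $\mathfrak a$ is a $p$-structure on $\mathfrak a_{\bar 0}$ with $\mathrm{ad}_{a^{[p]}}(b)=(\mathrm{ad}_a)^p(b)$ for all $a\in\mathfrak a_{\bar 0}$, $b\in\mathfrak a$ (for odd $a$ one puts $a^{[2p]}=(a^2)^{[p]}$, $a^2=\frac12[a,a]$). $\mathfrak a$ with a $p|2p$-map is called restricted. A bilinear form $\omega$ is (super) anti-symmetric if $\omega(a,b)=-(-1)^{|a||b|}\omega(b,a)$, and closed (a 2-cocycle) if $(-1)^{|a||c|}\omega(a,[b,c])+(-1)^{|c||b|}\omega(c,[a,b])+(-1)^{|b||a|}\omega(b,[c,a])=0$. $(\mathfrak a,\omega)$ is quasi-Frobenius if $\omega$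 is a non-degenerate closed anti-symmetric form; it is orthosymplectic if $\omega$ is even ($\omega(\mathfrak a_{\bar 0},\mathfrak a_{\bar 1})=\omega(\mathfrak a_{\bar 1},\mathfrak a_{\bar 0})=0$). The adjoint $\mathscr D^*$ of a derivation $\mathscr D$ is defined by $\omega(\mathscr D(a),b)=(-1)^{|a||\mathscr D|}\omega(a,\mathscr D^*(b))$. $\mathscr D$ is restricted if $\mathscr D(a^{[p]})=(\mathrm{ad}_a)^{p-1}(\mathscr D(a))$ for all $a\in\mathfrak a_{\bar 0}$; $\mathfrak{der}^p_{\bar 0}(\mathfrak a)$ is the space of even restricted derivations. $\mathscr D$ has the $p$-property if there are $\gamma\in\mathbb K$, $a_0\in\mathfrak a_{\bar 0}$ with $\mathscr D^p=\gamma\mathscr D+\mathrm{ad}_{a_0}$, $\mathscr D(a_0)=0$. Restricted cochains with trivial coefficients: for an anti-symmetric bilinear $\alpha:\mathfrak a\times\mathfrak a\to\mathbb K$, a map $\beta:\mathfrak a_{\bar 0}\to\mathbb K$ has the $*$-property with respect to $\alpha$ if $\beta(\delta a)=\delta^p\beta(a)$ and $\beta(a+b)=\beta(a)+\beta(b)+\sum\frac1{\pi\{a\}}\alpha([[\dots[x_1,x_2],x_3]\dots,x_{p-1}],x_p)$, the sum over all choices $x_i\in\{a,b\}$ with $x_1=a$, $x_2=b$, $\pi\{a\}$ being the number of $x_i$ equal to $a$. $C^2_*(\mathfrak a;\mathbb K)$ is the set of such pairs $(\alpha,\beta)$. $Z^2_*(\mathfrak a;\mathbb K)$ consists of those with $\alpha$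 closed and $\alpha(a,b^{[p]})-\alpha([[\dots[a,b],\dots],b],b)=0$ for $a,b\in\mathfrak a_{\bar 0}$ (with $p-1$ brackets by $b$ in the first entry). $B^2_*(\mathfrak a;\mathbb K)$ consists of those for which there is a linear $\varphi:\mathfrak a\to\mathbb K$ with $\alpha(a,b)=\varphi([a,b])$ and $\beta(a)=\varphi(a^{[p]})$. Maps: $C(a,b)=\omega_{\mathfrak a}((\mathscr D+\mathscr D^* )(a),b)$. Let $\sigma_i^{\mathfrak a}(a,b)$ be defined by $\omega_{\mathfrak a}\bigl((\mathscr D+\mathscr D^* )(\mu a+b),(\mathrm{ad}_{\mu a+b})^{p-2}(a)\bigr)=\sum_{i=1}^{p-1}i\,\sigma_i^{\mathfrak a}(a,b)\mu^{i-1}$. $P:\mathfrak a_{\bar 0}\to\mathbb K$ satisfies $P(\delta a)=\delta^pP(a)$ and $P(a+b)=P(a)+P(b)+\sum_{i=1}^{p-1}\sigma_i^{\mathfrak a}(a,b)$. Further, $\Omega(a,b)=\omega_{\mathfrak a}\bigl((\mathscr D\circ\mathscr D+2\mathscr D^*\circ\mathscr D+\mathscr D^*\circ\mathscr D^*+\lambda(\mathscr D+\mathscr D^* ))(a),b\bigr)$ for $a,b\in\mathfrak a$, and $T(a)=\omega_{\mathfrak a}\bigl((\mathscr D+\mathscr D^* )(a),(\mathrm{ad}_a)^{p-2}(\mathscr D(a))\bigr)+\lambda P(a)$ for $a\in\mathfrak a_{\bar 0}$. *)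

(* Defs.v *)
From HB Require Import structures.
From mathcomp Require Import all_boot all_order all_algebra.
Set Implicit Arguments.
Unset Strict Implicit.
Unset Printing Implicit Defensive.
Import GRing.Theory.
Local Open Scope ring_scope.

(* A superspace is a vectType V with a family V_ : bool -> {vspace V}, where   *)
(* V_ false is the even part, V_ true the odd part, and parities add by (+).   *)
(* Maps such as a |-> a^[p], P and T, which live on the even part only, are    *)
(* total functions on V whose values outside V_ false are never used.          *)

Section Superalgebras.
Variables (K : fieldType) (p : nat) (V : vectType K) (V_ : bool -> {vspace V}).

Definition koszul (i j : bool) : K := (-1) ^+ (i && j).

Definition is_grading : Prop :=
  (V_ false + V_ true)%VS = fullv /\ directv (V_ false + V_ true).

Definition is_lie_superalgebra (br : V -> V -> V) : Prop :=
  [/\ is_grading,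
      bilinear_for *:%R *:%R br,
      (forall i j a b, a \in V_ i -> b \in V_ j -> br a b \in V_ (i (+) j)),
      (forall i j a b, a \in V_ i -> b \in V_ j ->
         br a b = - (koszul i j *: br b a))
    & (forall i j k a b c, a \in V_ i -> b \in V_ j -> c \in V_ k ->
         br a (br b c) = br (br a b) c + koszul i j *: br b (br a c))
      /\ (forall u, u \in V_ true -> br u (br u u) = 0)].

Definition in_center (br : V -> V -> V) (z : V) : Prop :=
  forall a, br z a = 0.

(* A field of characteristic p has at least p elements and the polynomials in  *)
(* mu involved have degree < p, so the identity for all mu in K is the formal  *)
(* one: it determines s 1, ..., s (p - 1).                                     *)
Definition jacobson_terms (br : V -> V -> V) (a b : V) (s : nat -> V) : Prop :=
  forall mu : K, iter p.-1 (br (mu *: a + b)) a =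
    \sum_(1 <= i < p) (i%:R * mu ^+ i.-1) *: s i.

Definition is_p_structure (U : {vspace V}) (br : V -> V -> V) (pm : V -> V) :
    Prop :=
  [/\ (forall a, a \in U -> pm a \in U),
      (forall a b, a \in U -> b \in U -> br (pm a) b = iter p (br a) b),
      (forall c a, a \in U -> pm (c *: a) = c ^+ p *: pm a)
    & (forall a b, a \in U -> b \in U -> exists2 s, jacobson_terms br a b s &
         pm (a + b) = pm a + pm b + \sum_(1 <= i < p) s i)].

Definition is_p2p_map (br : V -> V -> V) (pm : V -> V) : Prop :=
  is_p_structure (V_ false) br pm /\
  (forall a b, a \in V_ false -> br (pm a) b = iter p (br a) b).

Definition antisymmetric_form (om : V -> V -> K) : Prop :=
  forall i j a b, a \in V_ i -> b \in V_ j -> om a b = - (koszul i j * om b a).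

Definition closed_form (br : V -> V -> V) (om : V -> V -> K) : Prop :=
  forall i j k a b c, a \in V_ i -> b \in V_ j -> c \in V_ k ->
    koszul i k * om a (br b c) + koszul k j * om c (br a b)
      + koszul j i * om b (br c a) = 0.

Definition nondegenerate_form (om : V -> V -> K) : Prop :=
  forall a, (forall b, om a b = 0) -> a = 0.

Definition is_quasi_frobenius (br : V -> V -> V) (om : V -> V -> K) : Prop :=
  [/\ bilinear_for *%R *%R om, antisymmetric_form om, closed_form br om
    & nondegenerate_form om].

Definition even_form (om : V -> V -> K) : Prop :=
  forall a b, a \in V_ false -> b \in V_ true -> om a b = 0 /\ om b a = 0.

Definition is_orthosymplectic_qf (br : V -> V -> V) (om : V -> V -> K) : Prop :=
  is_quasi_frobenius br om /\ even_form om.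

Definition is_derivation (br : V -> V -> V) (d : bool) (D : V -> V) : Prop :=
  (forall i a, a \in V_ i -> D a \in V_ (d (+) i)) /\
  (forall i a b, a \in V_ i ->
     D (br a b) = br (D a) b + koszul d i *: br a (D b)).

Definition restricted_derivation (br : V -> V -> V) (pm D : V -> V) : Prop :=
  forall a, a \in V_ false -> D (pm a) = iter p.-1 (br a) (D a).

Definition p_property (br : V -> V -> V) (D : V -> V) (gamma : K) (a0 : V) :
    Prop :=
  [/\ a0 \in V_ false, (forall a, iter p D a = gamma *: D a + br a0 a)
    & D a0 = 0].

Definition is_adjoint (om : V -> V -> K) (d : bool) (D Ds : V -> V) : Prop :=
  forall i a b, a \in V_ i -> om (D a) b = koszul i d * om a (Ds b).

(* The word x_1 ... x_p in {a, b} is coded by w : p.-tuple bool, with          *)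
(* x_(i+1) = a iff w`_i = true.                                                *)
Definition star_sum (br : V -> V -> V) (alpha : V -> V -> K) (a b : V) : K :=
  \sum_(w : p.-tuple bool | nth false w 0 && ~~ nth true w 1)
     let x i := if nth false w i then a else b in
     (count id w)%:R^-1 *
       alpha (foldl br (x 0%N) [seq x i | i <- iota 1 p.-2]) (x p.-1).

Definition star_property (br : V -> V -> V) (alpha : V -> V -> K)
    (beta : V -> K) : Prop :=
  (forall c a, a \in V_ false -> beta (c *: a) = c ^+ p * beta a) /\
  (forall a b, a \in V_ false -> b \in V_ false ->
     beta (a + b) = beta a + beta b + star_sum br alpha a b).

Definition in_C2 (br : V -> V -> V) (alpha : V -> V -> K) (beta : V -> K) :
    Prop :=
  [/\ bilinear_for *%R *%R alpha, antisymmetric_form alpha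
    & star_property br alpha beta].

Definition in_Z2 (br : V -> V -> V) (pm : V -> V) (alpha : V -> V -> K)
    (beta : V -> K) : Prop :=
  [/\ in_C2 br alpha beta, closed_form br alpha
    & (forall a b, a \in V_ false -> b \in V_ false ->
         alpha a (pm b) - alpha (iter p.-1 (br^~ b) a) b = 0)].

Definition in_B2 (br : V -> V -> V) (pm : V -> V) (alpha : V -> V -> K)
    (beta : V -> K) : Prop :=
  in_C2 br alpha beta /\
  exists phi : {scalar V}, (forall a b, alpha a b = phi (br a b)) /\
    (forall a, a \in V_ false -> beta a = phi (pm a)).

Definition Cform (om : V -> V -> K) (D Ds : V -> V) (a b : V) : K :=
  om (D a + Ds a) b.

(* As in jacobson_terms, these identities determine s 1, ..., s (p - 1).       *)
Definition sigma_terms (br : V -> V -> V) (om : V -> V -> K) (D Ds : V -> V)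
    (a b : V) (s : nat -> K) : Prop :=
  forall mu : K,
    om (D (mu *: a + b) + Ds (mu *: a + b)) (iter p.-2 (br (mu *: a + b)) a) =
    \sum_(1 <= i < p) i%:R * s i * mu ^+ i.-1.

Definition is_Pmap (br : V -> V -> V) (om : V -> V -> K) (D Ds : V -> V)
    (P : V -> K) : Prop :=
  (forall c a, a \in V_ false -> P (c *: a) = c ^+ p * P a) /\
  (forall a b, a \in V_ false -> b \in V_ false ->
     exists2 s, sigma_terms br om D Ds a b s &
       P (a + b) = P a + P b + \sum_(1 <= i < p) s i).

Definition Omega (om : V -> V -> K) (D Ds : V -> V) (lam : K) (a b : V) : K :=
  om (D (D a) + Ds (D a) *+ 2 + Ds (Ds a) + lam *: (D a + Ds a)) b.

Definition Tmap (br : V -> V -> V) (om : V -> V -> K) (D Ds : V -> V)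
    (lam : K) (P : V -> K) (a : V) : K :=
  om (D a + Ds a) (iter p.-2 (br a) (D a)) + lam * P a.

End Superalgebras.

Section DoubleExtension.
Variables (K : fieldType) (V : vectType K).

(* (s, a, t) stands for s x + a + t x^*.                                       *)
Definition dext : vectType K := (K^o * V * K^o)%type.

Definition dx : dext := (1, 0, 0).
Definition dxs : dext := (0, 0, 1).
Definition dinj (a : V) : dext := (0, a, 0).

Fact dinj_is_linear : linear dinj.
Proof.
move=> c a b.
have e : 0 = c *: 0 + 0 :> K^o by rewrite scaler0 addr0.
by rewrite /dinj {1 2}e.
Qed.

HB.instance Definition _ := GRing.isLinear.Build K V dext _ dinj dinj_is_linear.

Definition dgrading (V_ : bool -> {vspace V}) (i : bool) : {vspace dext} :=
  (if i then linfun dinj @: V_ true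
   else <[dx]> + linfun dinj @: V_ false + <[dxs]>)%VS.

End DoubleExtension.

Arguments dx {K V}.
Arguments dxs {K V}.

(* Main.v *)
Require Import Defs.
From HB Require Import structures.
From mathcomp Require Import all_boot all_order all_algebra.
From mathcomp Require Import ring.
Import GRing.Theory.
Set Implicit Arguments.
Unset Strict Implicit.
Unset Printing Implicit Defensive.
Local Open Scope ring_scope.

(* The Lie superalgebra g is a double extension, and each of its axioms is one
   of the cocycle conditions on D, C and Omega. For the p|2p-map, Jacobson's
   theorem would extend prescribed p-th powers of a basis by means of the
   enveloping algebra. Here the form omega_g makes that unnecessary: the even
   part of g acts faithfully on the central extension g (+) K by rho,
   rho(y)(z, t) = ([y, z], omega_g(y, z)), so Jacobson's formula may be applied in
   the associative algebra End(g (+) K). A map y |-> y^[p] is then a p-structure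
   when rho(y^[p]) - rho(y)^p is p-semilinear and acts trivially on g, and such a
   defect is determined by its values on a_0, x and xs (= x^* ). The conditions
   (a), (b) and (c) express that ad(xs)^p = ad(gamma xs + a_0 + lamt x) and that
   b_0 + sigma x + delta xs is central, ad(x)^2 being zero. *)

(** * Jacobson's formula *)

Section JacobsonFormula.
Variables (K : fieldType) (p : nat).
Hypothesis char_p : p \in [pchar K].

Let p_prime : prime p. Proof. exact: pcharf_prime char_p. Qed.

Lemma pchar_natf_neq0 i : (0 < i < p)%N -> i%:R != 0 :> K.
Proof.
case/andP=> i_gt0 i_lt_p; rewrite -(dvdn_pcharf char_p).
by apply: contraL i_lt_p => /(dvdn_leq i_gt0); rewrite -leqNgt.
Qed.

Lemma even_pred_pchar : (2 < p)%N -> ~~ odd p.-1.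
Proof.
move=> p_gt2; have [p2|] := even_prime p_prime; first by rewrite p2 in p_gt2.
by rewrite -[p in odd p](prednK (prime_gt0 p_prime)).
Qed.

(** The images of 0, ..., p - 1 in K are distinct, so their Vandermonde matrix is invertible. Hence
    an identity in mu of degree below p that holds at every scalar holds coefficientwise. *)
Lemma polynomial_coef_eq0 (M : lmodType K) (v : nat -> M) :
  (forall mu : K, \sum_(i < p) mu ^+ i *: v i = 0) ->
  forall i, (i < p)%N -> v i = 0.
Proof.
move=> v0 k k_lt_p; set W := Vandermonde p (\row_(j < p) (j%:R : K)).
have W_unit : W \in unitmx.
  rewrite unitmxE det_Vandermonde unitfE; apply/prodf_neq0 => i _.
  apply/prodf_neq0 => j ij; rewrite !mxE -natrB; last exact: ltnW.
  by apply: pchar_natf_neq0; rewrite subn_gt0 ij (leq_ltn_trans (leq_subr _ _)).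
have E j : \sum_(i < p) W i j *: v i = 0.
  by rewrite -[RHS](v0 j%:R); apply: eq_bigr => i _; rewrite !mxE.
have /(congr1 (fun A : 'M_p => \sum_(i < p) A i (Ordinal k_lt_p) *: v i)) :=
  mulmxV W_unit.
rewrite (eq_bigr (fun i => \sum_j invmx W j (Ordinal k_lt_p) *: (W i j *: v i))).
  rewrite exchange_big big1 => [/esym/=|j _].
    rewrite (bigD1 (Ordinal k_lt_p)) //= mxE eqxx scale1r big1 ?addr0 //.
    by move=> i /negPf ne; rewrite mxE ne scale0r.
  by rewrite -scaler_sumr E scaler0.
move=> i _; rewrite mxE scaler_suml; apply: eq_bigr => j _.
by rewrite scalerA mulrC.
Qed.

(** Pascal's rule and the vanishing of ['C(p, i.+1)] in K: consecutive entries of row p - 1 are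
    opposite. *)
Lemma pchar_binomial_pred (i : nat) :
  (i < p)%N -> (-1) ^+ i * 'C(p.-1, i)%:R = 1 :> K.
Proof.
elim: i => [|i IHi] i_lt; first by rewrite expr0 bin0 mulr1.
have : ('C(p, i.+1)%:R : K) = 0.
  by apply/eqP; rewrite -(dvdn_pcharf char_p) prime_dvd_bin.
rewrite -[p in 'C(p, _)](prednK (prime_gt0 p_prime)) binS natrD => /eqP.
rewrite addr_eq0 => /eqP ->; rewrite exprS mulN1r mulrNN; exact: IHi (ltnW _).
Qed.

Section Ring.
Variable R : algType K.
Implicit Types A B Y : R.

(** Left and right multiplication by Y commute, so this is the binomial theorem for their
    difference. *)
Lemma iter_commutator n Y A :
  iter n (fun X => Y * X - X * Y) A =
  \sum_(i < n.+1) ((-1) ^+ i * 'C(n, i)%:R) *: (Y ^+ (n - i) * A * Y ^+ i).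
Proof.
elim: n => [|n IHn]; first by rewrite big_ord1 bin0 !expr0 !mul1r scale1r mulr1.
rewrite iterS IHn mulr_sumr mulr_suml big_ord_recl [RHS]big_ord_recl.
rewrite !bin0 !expr0 !mul1r !scale1r !mulr1 !subn0 mulrA -exprS -addrA.
congr (_ + _).
rewrite [X in _ - X]big_ord_recr [RHS]big_ord_recr /= opprD addrA; congr (_ + _).
  rewrite -sumrB; apply: eq_bigr => i _; rewrite /bump /= add1n.
  rewrite binS natrD mulrDr scalerDl -scalerAr -scalerAl; congr (_ + _).
    by rewrite !mulrA -exprS subSS subnSK.
  by rewrite -scaleNr -mulNr exprS mulN1r subSS -!mulrA -exprSr.
by rewrite !binn /bump /= add1n !mulr1 !subnn !expr0 !mul1r -scalerAl -scaleNr
  exprS mulN1r -!mulrA -exprSr.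
Qed.

(** All signed binomials are 1, which leaves the derivative of Y^p in the direction A. *)
Lemma iter_commutator_pchar Y A :
  iter p.-1 (fun X => Y * X - X * Y) A =
  \sum_(i < p) Y ^+ (p.-1 - i) * A * Y ^+ i.
Proof.
rewrite iter_commutator (prednK (prime_gt0 p_prime)).
by apply: eq_bigr => i _; rewrite pchar_binomial_pred ?scale1r.
Qed.

Let lin A B : {poly R} := A%:P * 'X + B%:P.

Let deriv_lin_exp A B n :
  (lin A B ^+ n)^`() = \sum_(i < n) lin A B ^+ (n.-1 - i) * A%:P * lin A B ^+ i.
Proof.
elim: n => [|n IHn]; first by rewrite big_ord0 expr0 derivC.
rewrite exprSr derivM IHn /lin derivD derivC addr0 derivM derivC mul0r add0r derivX.
rewrite mulr1 mulr_suml addrC big_ord_recl /= subn0 expr0 mulr1; congr (_ + _).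
apply: eq_bigr => i _; rewrite /bump /= add1n exprSr mulrA.
by case: n i IHn => [[]//|n] i _; rewrite subSS.
Qed.

(** R need not be commutative, but scalars are central; this makes evaluation at a scalar
    multiplicative. *)
Let scal_comm (c : K) (q : {poly R}) : comm_poly q c%:A.
Proof.
rewrite /comm_poly (_ : c%:A * q.[c%:A] = c *: q.[c%:A]); last first.
  by rewrite -scalerAl mul1r.
by rewrite -scalerAr mulr1.
Qed.

Let horner_lin A B (c : K) n : (lin A B ^+ n).[c%:A] = (c *: A + B) ^+ n.
Proof.
rewrite horner_exp_comm; last exact: scal_comm.
by rewrite !hornerE_comm -scalerAr mulr1.
Qed.

Let size_lin A B n : (size (lin A B ^+ n) <= n.+1)%N.
Proof.
apply: leq_trans (size_poly_exp_leq _ _) _; rewrite ltnS -[leqRHS]mul1n leq_mul2r.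
rewrite /lin size_MXaddC; case: ifP => _; first by rewrite orbT.
by rewrite /= size_polyC leq_b1 orbT.
Qed.

Let coef_lin A B n : (lin A B ^+ n)`_n = A ^+ n.
Proof.
elim: n => [|n IHn]; first by rewrite !expr0 coef1.
rewrite !exprS {1}/lin mulrDl coefD -mulrA !coefCM coefXM IHn.
by rewrite (nth_default _ (size_lin A B n)) mulr0 addr0.
Qed.

(** Let q = (A X + B)^p. Evaluated at mu, q' is the iterated commutator of the hypothesis, so
    comparing coefficients gives i q_i = i s_i for 0 < i < p. The end coefficients are B^p and A^p,
    and evaluation at 1 gives the formula. *)
Theorem jacobson_formula A B (s : nat -> R) :
  (forall mu : K, let Y := mu *: A + B in
     iter p.-1 (fun X => Y * X - X * Y) A =
     \sum_(1 <= i < p) (i%:R * mu ^+ i.-1) *: s i) ->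
  (A + B) ^+ p = A ^+ p + B ^+ p + \sum_(1 <= i < p) s i.
Proof.
move=> s_terms; set q := lin A B ^+ p; have p_gt0 := prime_gt0 p_prime.
have size_dq : (size q^`() <= p)%N.
  have [->|q_neq0] := eqVneq q 0; first by rewrite linear0 size_poly0.
  by rewrite -ltnS (leq_trans (lt_size_deriv q_neq0)) ?size_lin.
have scal_exp (mu : K) j : mu%:A ^+ j = (mu ^+ j)%:A :> R.
  by rewrite exprZn expr1n.
have q_coef i : (0 < i < p)%N -> q`_i = s i.
  case: i => // i i_lt; have /scalerI : i.+1%:R != 0 :> K.
    exact: pchar_natf_neq0.
  apply; apply/eqP; rewrite -subr_eq0; apply/eqP.
  (* The Jacobson sum has degree at most p - 2 in mu, so the coefficient at j = p - 1 is compared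
     with 0. *)
  pose v j := q^`()`_j - (if (j.+1 < p)%N then j.+1%:R *: s j.+1 else 0).
  have /(polynomial_coef_eq0 (v := v)) :
      forall mu : K, \sum_(j < p) mu ^+ j *: v j = 0.
    move=> mu; rewrite (eq_bigr (fun j : 'I_p => q^`()`_j * mu%:A ^+ j -
       (if (j.+1 < p)%N then (j.+1%:R * mu ^+ j) *: s j.+1 else 0))); last first.
      move=> j _; rewrite /v scalerBr scal_exp -scalerAr mulr1; congr (_ - _).
      by case: ifP; rewrite ?scaler0 // scalerA mulrC.
    rewrite sumrB -(horner_coef_wide _ size_dq) {1}/q deriv_lin_exp horner_sum.
    under eq_bigr => j _ do
      rewrite hornerM_comm ?hornerM_comm ?horner_lin ?hornerC //.
    rewrite -iter_commutator_pchar s_terms big_add1 -big_mkcond /=.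
    apply/eqP; rewrite subr_eq0; apply/eqP; rewrite big_mkord.
    rewrite (big_ord_widen_cond p xpredT (fun j => (j.+1%:R * mu ^+ j) *: s j.+1)).
      by apply: eq_bigl => j; rewrite -ltnS (prednK p_gt0).
    exact: leq_pred.
  move=> /(_ i (ltnW i_lt)).
  by rewrite /v (i_lt : (i.+1 < p)%N) coef_deriv !scaler_nat.
have := horner_lin A B 1 p.
rewrite !scale1r => <-; rewrite (horner_coef_wide _ (size_lin A B p)).
rewrite big_ord_recr /= coef_lin expr1n mulr1 addrC -addrA; congr (_ + _).
rewrite -(big_mkord xpredT (fun i => q`_i * 1 ^+ i)) big_ltn //= expr0 mulr1.
have -> : q`_0 = B ^+ p.
  by have := horner_lin A B 0 p; rewrite !scale0r add0r horner_coef0.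
congr (_ + _).
rewrite !big_nat; apply: eq_bigr => i i_lt.
by rewrite expr1n mulr1 q_coef.
Qed.
End Ring.
End JacobsonFormula.

(** The axioms are required only on a subspace S, which need not be a subalgebra, so that S can grow
    by one basis vector at a time. The adjoint condition is tested on all of L, hence also on odd
    elements. *)
Definition partial_p_map (K : fieldType) (p : nat) (L : vectType K)
    (U S : {vspace L}) (br : L -> L -> L) (pm : L -> L) : Prop :=
  [/\ forall a, a \in S -> pm a \in U,
      forall a b, a \in S -> br (pm a) b = iter p (br a) b,
      forall c a, a \in S -> pm (c *: a) = c ^+ p *: pm a
    & forall a b, a \in S -> b \in S -> exists2 s, jacobson_terms p br a b s &
        pm (a + b) = pm a + pm b + \sum_(1 <= i < p) s i].

(** * Partial p-maps from a faithful representation *)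

Section PStructureOfRepresentation.
Variables (K : fieldType) (p : nat).
Hypothesis char_p : p \in [pchar K].
Variables (L : vectType K) (U : {vspace L}) (br : {bilinear L -> L -> L}).
Hypothesis br_closed : forall a b, a \in U -> b \in U -> br a b \in U.

Lemma iter_br_closed n a b : a \in U -> b \in U -> iter n (br a) b \in U.
Proof. by move=> Ua Ub; elim: n => //= n; apply: br_closed. Qed.

(** [v] lists the coefficients in mu of the n-fold bracket by mu a + b. The top one is kept
    explicit, since its vanishing for c = a is what produces Jacobson terms. *)
Lemma iter_br_pencil n a b c : a \in U -> b \in U -> c \in U ->
  exists v : nat -> L, [/\ forall i, v i \in U, forall i, (n < i)%N -> v i = 0,
    v n = iter n (br a) c
  & forall mu : K, iter n (br (mu *: a + b)) c = \sum_(i < n.+1) mu ^+ i *: v i].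
Proof.
move=> Ua Ub Uc; elim: n => [|n [v [Uv v0 vn vE]]].
  exists (fun i => if i == 0%N then c else 0); split=> [i|[]//||mu] //.
    by case: ifP; rewrite ?mem0v.
  by rewrite big_ord1 scale1r.
exists (fun i => br b (v i) + (if i is j.+1 then br a (v j) else 0)); split.
- by move=> [|i]; rewrite memvD ?br_closed ?mem0v.
- by move=> [|i] //= i_gt; rewrite !v0 // ?linear0r ?addr0 // ltnW.
- by rewrite v0 // linear0r add0r vn.
move=> mu; rewrite iterS vE linearDl linearZl_LR /= addrC.
under [RHS]eq_bigr do rewrite scalerDr.
rewrite big_split /= [X in _ = X + _]big_ord_recr [X in _ = _ + X]big_ord_recl /=.
rewrite v0 // linear0r !scaler0 addr0 add0r !linear_sumr scaler_sumr /=.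
congr (_ + _); apply: eq_bigr => i _; rewrite linearZr_LR //=.
by rewrite scalerA -exprS.
Qed.

Hypothesis br_alt : forall a, a \in U -> br a a = 0.

(** The coefficient of mu^(p-1) is (ad a)^(p-1)(a), zero since [a, a] = 0. The remaining ones are
    indexed by 0 < i < p after a shift, and such i are invertible in K. *)
Lemma exists_jacobson_terms a b : a \in U -> b \in U ->
  exists2 s, jacobson_terms p br a b s & forall i, s i \in U.
Proof.
move=> Ua Ub; have [v [Uv _ vp vE]] := iter_br_pencil p.-1 Ua Ub Ua.
exists (fun i => i%:R^-1 *: v i.-1) => [mu|i]; last by rewrite memvZ.
have vp0 : v p.-1 = 0.
  have p_gt1 := prime_gt1 (pcharf_prime char_p).
  rewrite vp -(ltn_predK (_ : 0 < p.-1)%N) ?ltn_predRL // iterSr br_alt //.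
  by elim: p.-2 => //= n ->; rewrite linear0r.
rewrite vE big_ord_recr /= vp0 scaler0 addr0 big_add1 big_mkord.
apply: eq_bigr => i _; rewrite scalerA mulrAC divff ?mul1r //.
by rewrite (pchar_natf_neq0 char_p) // -ltn_predRL ltn_ord.
Qed.

Variables (R : algType K) (rho : {linear L -> R}).
Hypothesis rho_br : forall a b, a \in U -> b \in U ->
  rho (br a b) = rho a * rho b - rho b * rho a.

Lemma jacobson_formula_rep a b s : a \in U -> b \in U ->
  jacobson_terms p br a b s ->
  rho (a + b) ^+ p =
    rho a ^+ p + rho b ^+ p + rho (\sum_(1 <= i < p) s i).
Proof.
move=> Ua Ub s_terms; rewrite linearD linear_sum.
apply: (jacobson_formula char_p) => mu Y; have UY : mu *: a + b \in U.
  by rewrite memvD ?memvZ.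
have -> n : iter n (fun X => Y * X - X * Y) (rho a) =
            rho (iter n (br (mu *: a + b)) a).
  elim: n => //= n ->; rewrite rho_br ?iter_br_closed //.
  by rewrite linearD linearZ.
by rewrite s_terms linear_sum; apply: eq_bigr => i _; rewrite linearZ.
Qed.

Variables (S : {vspace L}) (rhoV : R -> L) (N : L -> R).
Hypotheses (S_sub : (S <= U)%VS) (rhoK : cancel rho rhoV)
  (N_add : forall a b, a \in S -> b \in S -> N (a + b) = N a + N b)
  (N_scale : forall c a, a \in S -> N (c *: a) = c ^+ p *: N a).

(** z is the candidate for the p-th power of a: [rho] represents it as rho(a)^p corrected by the
    p-semilinear defect [N]. *)
Definition p_liftable (a z : L) :=
  [/\ a \in S, z \in U & rho z = rho a ^+ p + N a].

Lemma p_liftable_jacobson a b y z s :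
  p_liftable a y -> p_liftable b z ->
  jacobson_terms p br a b s -> (forall i, s i \in U) ->
  p_liftable (a + b) (y + z + \sum_(1 <= i < p) s i).
Proof.
move=> [Sa Uy rho_y] [Sb Uz rho_z] s_terms Us; split.
- by rewrite memvD.
- by rewrite !memvD // memv_suml.
have [Ua Ub] := (subvP S_sub _ Sa, subvP S_sub _ Sb).
rewrite (jacobson_formula_rep Ua Ub s_terms) !linearD /= rho_y rho_z N_add //.
by rewrite [RHS]addrAC -!addrA; congr (_ + _); rewrite [LHS]addrCA.
Qed.

Lemma p_liftableD a b y z : p_liftable a y -> p_liftable b z ->
  exists t, p_liftable (a + b) t.
Proof.
move=> ay bz; have [[Sa _ _] [Sb _ _]] := (ay, bz).
have [s s_terms Us] :=
  exists_jacobson_terms (subvP S_sub _ Sa) (subvP S_sub _ Sb).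
by eexists; apply: p_liftable_jacobson ay bz s_terms Us.
Qed.

Lemma p_liftableZ c a z : p_liftable a z -> p_liftable (c *: a) (c ^+ p *: z).
Proof.
move=> [Sa Uz rho_z]; split; rewrite ?memvZ //.
by rewrite !linearZ /= rho_z exprZn N_scale // scalerDr.
Qed.

Definition rep_p_map (a : L) : L := rhoV (rho a ^+ p + N a).

Lemma rep_p_mapE a z : p_liftable a z -> rep_p_map a = z.
Proof. by move=> [_ _ rho_z]; rewrite /rep_p_map -rho_z rhoK. Qed.

Hypothesis S_liftable : forall a, a \in S -> exists z, p_liftable a z.

Lemma rep_p_map_liftable a : a \in S -> p_liftable a (rep_p_map a).
Proof. by move=> /S_liftable[z az]; rewrite (rep_p_mapE az). Qed.

(** Liftability is stable under scaling and under the Jacobson sum, and injectivity of [rho] makes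
    the lift unique; only the adjoint condition has to be supplied separately. *)
Lemma rep_partial_p_map :
  (forall a b, a \in S -> br (rep_p_map a) b = iter p (br a) b) ->
  partial_p_map p U S br rep_p_map.
Proof.
move=> pmap_ad; split=> // [a /rep_p_map_liftable[]//|c a Sa|a b Sa Sb].
  exact/rep_p_mapE/p_liftableZ/rep_p_map_liftable.
have [s s_terms Us] :=
  exists_jacobson_terms (subvP S_sub _ Sa) (subvP S_sub _ Sb).
exists s => //; apply/rep_p_mapE/p_liftable_jacobson => //;
  exact: rep_p_map_liftable.
Qed.

End PStructureOfRepresentation.

(** * The central extension of a quasi-Frobenius Lie superalgebra *)

(* MathComp's lfun_algType carries the opposite product [g \o f]. *)
Section EndomorphismAlgebra.
Variables (K : fieldType) (W : vectType K) (W_proper : (0 < dim W)%N).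

Definition end_lalgMixin :=
  GRing.Lmodule_isLalgebra.Build K (lfun_comp_nzRingType W_proper)
    (fun k f g => comp_lfunZl k f g).

Definition end_lalgType : lalgType K :=
  HB.pack 'End(W) (lfun_comp_nzRingType W_proper) end_lalgMixin.

Definition end_algMixin := GRing.Lalgebra_isAlgebra.Build K end_lalgType
  (fun k f g => comp_lfunZr k f g).

Definition end_algType : algType K := HB.pack 'End(W) end_lalgType end_algMixin.

End EndomorphismAlgebra.

Section CentralExtension.
Variables (K : fieldType) (L : vectType K) (br : {bilinear L -> L -> L})
  (om : {biscalar L}).

Definition cext : vectType K := (L * K^o)%type.

Definition cext_ad (y : L) (w : cext) : cext := (br y w.1, om y w.1).

Fact cext_ad_is_linear y : linear (cext_ad y).
Proof.
by move=> c u v; rewrite /cext_ad /= !linearDr !linearZr_LR.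
Qed.

HB.instance Definition _ y :=
  GRing.isLinear.Build K cext cext _ (cext_ad y) (cext_ad_is_linear y).

Fact cext_proper : (0 < dim cext)%N.
Proof. exact: ltn_addl. Qed.

Definition cext_end : algType K := end_algType cext_proper.

Definition cext_rep (y : L) : cext_end := linfun (cext_ad y).

Lemma cext_repE y (w : cext) : (cext_rep y : 'End(cext)) w = cext_ad y w.
Proof. exact: lfunE. Qed.

Fact cext_rep_is_linear : linear cext_rep.
Proof.
move=> c y z; apply/lfunP => w; rewrite cext_repE.
transitivity (c *: cext_ad y w + cext_ad z w).
  by rewrite /cext_ad !linearDl !linearZl_LR.
by rewrite -!cext_repE -scale_lfunE -add_lfunE.
Qed.

HB.instance Definition _ :=
  GRing.isLinear.Build K L cext_end _ cext_rep cext_rep_is_linear.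

End CentralExtension.

(** * The faithful representation and the extension of p-maps by one vector *)

Section QuasiFrobenius.
Variables (K : fieldType) (p : nat).
Hypothesis char_p : p \in [pchar K].
Variables (L : vectType K) (L_ : bool -> {vspace L}) (br : {bilinear L -> L -> L})
  (om : {biscalar L}).
Hypotheses (lieL : is_lie_superalgebra L_ br)
  (qfL : is_orthosymplectic_qf L_ br om).

Let rho := cext_rep br om.

Lemma homogeneous_ind (Q : L -> Prop) :
  (forall i a, a \in L_ i -> Q a) ->
  (forall a b, Q a -> Q b -> Q (a + b)) -> forall a, Q a.
Proof.
move=> Qhom QD a; have [[full _] _ _ _ _] := lieL.
have : a \in (L_ false + L_ true)%VS by rewrite full memvf.
by case/memv_addP=> a0 L0 [a1 L1 ->]; apply: QD; apply: Qhom; eassumption.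
Qed.

Lemma br_even_closed a b : a \in L_ false -> b \in L_ false -> br a b \in L_ false.
Proof. by have [_ _ cl _ _] := lieL => La Lb; apply: (cl false false). Qed.

Lemma jacobi_even a b c : a \in L_ false -> b \in L_ false ->
  br (br a b) c = br a (br b c) - br b (br a c).
Proof.
move=> La Lb; have [_ _ _ _ [jac _]] := lieL.
elim/homogeneous_ind: c => [k c Lc|c d IHc IHd].
  by rewrite (jac false false k a b c) // /koszul expr0 scale1r addrK.
by rewrite !linearDr /= IHc IHd opprD addrACA.
Qed.

(** Closedness in the shape of a commutator relation, as the second coordinate of [rho] needs it. *)
Lemma closed_even a b c : a \in L_ false -> b \in L_ false ->
  om (br a b) c = om a (br b c) - om b (br a c).
Proof.
move=> La Lb; have [_ _ cl anti _] := lieL.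
have [[_ omA omC _] _] := qfL.
elim/homogeneous_ind: c => [k c Lc|c d IHc IHd].
  have := omC false false k a b c La Lb Lc.
  have Lab := br_even_closed La Lb.
  rewrite (omA _ _ _ _ Lc Lab) (anti _ _ _ _ Lc La).
  rewrite /koszul /= andbF !expr0 !mul1r scale1r linearNr /=.
  by move/eqP; rewrite addrAC subr_eq0 => /eqP.
by rewrite !linearDr /= IHc IHd opprD addrACA.
Qed.

Lemma cext_rep_br a b : a \in L_ false -> b \in L_ false ->
  rho (br a b) = rho a * rho b - rho b * rho a.
Proof.
move=> La Lb; apply/lfunP => w.
transitivity (cext_ad br om a (cext_ad br om b w) -
              cext_ad br om b (cext_ad br om a w)).
  by rewrite cext_repE /cext_ad /= jacobi_even // closed_even.
by rewrite -!cext_repE -!comp_lfunE -opp_lfunE -add_lfunE.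
Qed.

Lemma cext_rep_exp n a (w : cext L) :
  (((rho a ^+ n : cext_end L) : 'End(cext L)) w).1 = iter n (br a) w.1.
Proof.
elim: n => [|n IHn]; first by rewrite expr0 id_lfunE.
by rewrite exprS /= -IHn comp_lfunE cext_repE.
Qed.

Hypothesis p_gt2 : (2 < p)%N.

Lemma br_even_alt a : a \in L_ false -> br a a = 0.
Proof.
move=> La; have [_ _ _ anti _] := lieL; apply/eqP.
have := anti _ _ _ _ La La; rewrite /koszul scale1r => /eqP.
rewrite -addr_eq0 -mulr2n -scaler_nat scaler_eq0 => /orP[|//].
by rewrite (negPf (pchar_natf_neq0 char_p _)).
Qed.

Definition cext_rep_inv (M : cext_end L) : L :=
  ((linfun rho : 'Hom(L, 'End(cext L)))^-1)%VF (M : 'End(cext L)).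

(** Nondegeneracy makes [rho] injective: the second coordinate of rho(y)(b, 0) is om(y, b). *)
Lemma cext_repK : cancel rho cext_rep_inv.
Proof.
have inj : lker (linfun rho : 'Hom(L, 'End(cext L))) == 0%VS.
  apply/lker0P=> y z; rewrite !lfunE /= => /lfunP eq_yz.
  have [[_ _ _ nd] _] := qfL; apply/eqP; rewrite -subr_eq0; apply/eqP/nd => b.
  have /(congr1 snd) := eq_yz (b, 0); rewrite !cext_repE /= => om_yz.
  by rewrite linearBl /= om_yz subrr.
move=> y; rewrite /cext_rep_inv.
by rewrite -[rho y](lfunE rho) lker0_lfunK.
Qed.

(* Correcting [rho a ^+ p] by the p-semilinear defect [N] keeps it in the image
   of [rho]: this replaces the enveloping algebra in Jacobson's theorem. *)
Theorem partial_p_map_extend (S : {vspace L}) (pm : L -> L) (tau : {scalar L})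
    (e y : L) :
  (S <= L_ false)%VS -> partial_p_map p (L_ false) S br pm ->
  e \in L_ false -> y \in L_ false -> (forall b, br y b = iter p (br e) b) ->
  (forall a, a \in S -> tau a = 0) -> tau e = 1 ->
  exists pm', [/\ partial_p_map p (L_ false) (S + <[e]>) br pm',
    forall a, a \in S -> pm' a = pm a & pm' e = y].
Proof.
move=> S_even [pmU pm_ad pmZ pmD] Le Ly y_ad tauS taue.
have p_gt0 := prime_gt0 (pcharf_prime char_p).
have rhoD : {morph rho : u v / u + v} := linearD _.
have rhoZ c : {morph rho : u / c *: u} by move=> u; apply: linearZ.
(* [N0] is the defect of the given map on S. Since a - tau(a) e lies in S, [N] extends it
   p-semilinearly, with the value at e dictated by the prescribed power y. *)
pose N0 a := rho (pm a) - rho a ^+ p.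
pose N a := N0 (a - tau a *: e) + tau a ^+ p *: (rho y - rho e ^+ p).
have S1_even : (S + <[e]> <= L_ false)%VS by rewrite subv_add S_even memvE in Le *.
have S1P a : a \in (S + <[e]>)%VS -> a - tau a *: e \in S.
  case/memv_addP => b Sb [_ /vlineP[t ->] ->].
  have -> : tau (b + t *: e) = t.
    by rewrite linearD linearZ /= tauS // taue mulr1 add0r.
  by rewrite addrK.
have N0D a b : a \in S -> b \in S -> N0 (a + b) = N0 a + N0 b.
  move=> Sa Sb; have [s s_terms pmab] := pmD a b Sa Sb.
  rewrite /N0 (jacobson_formula_rep char_p br_even_closed cext_rep_br _ _ s_terms)
    ?(subvP S_even) //.
  by rewrite pmab !rhoD opprD addrACA subrr addr0 opprD addrACA.
have N0Z c a : a \in S -> N0 (c *: a) = c ^+ p *: N0 a.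
  move=> Sa; rewrite /N0 pmZ // !rhoZ exprZn.
  by rewrite scalerBr.
have Ntau0 : (0 : K) ^+ p = 0 by rewrite expr0n eqn0Ngt p_gt0.
have N00 : N0 0 = 0.
  by rewrite -[X in N0 X](scale0r (0 : L)) N0Z ?mem0v // Ntau0 scale0r.
have N_S a : a \in S -> N a = N0 a.
  by move=> Sa; rewrite /N tauS // scale0r subr0 Ntau0 scale0r addr0.
have N_D a b : a \in (S + <[e]>)%VS -> b \in (S + <[e]>)%VS -> N (a + b) = N a + N b.
  move=> S1a S1b; rewrite /N linearD /= scalerDl opprD addrACA N0D ?S1P //.
  rewrite -!(pFrobenius_autE char_p) rmorphD /= scalerDl. exact: addrACA.
have N_Z c a : a \in (S + <[e]>)%VS -> N (c *: a) = c ^+ p *: N a.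
  have tauZ : tau (c *: a) = c * tau a by rewrite linearZ.
  move=> S1a; rewrite /N tauZ -scalerA -scalerBr N0Z ?S1P //.
  by rewrite exprMn [RHS]scalerDr scalerA.
have e_lift : p_liftable p (L_ false) rho (S + <[e]>) N e y.
  split=> //; first by rewrite (subvP (addvSr _ _)) ?memv_line.
  rewrite /N taue scale1r subrr expr1n scale1r.
  by rewrite N00 add0r addrC subrK.
have S_lift a : a \in S -> p_liftable p (L_ false) rho (S + <[e]>) N a (pm a).
  move=> Sa; split; rewrite ?pmU ?(subvP (addvSl _ _)) //.
  by rewrite N_S // addrC subrK.
have lift a : a \in (S + <[e]>)%VS ->
    exists z, p_liftable p (L_ false) rho (S + <[e]>) N a z.
  move=> S1a; rewrite -(subrK (tau a *: e) a).
  exact: (p_liftableD char_p br_even_closed br_even_alt cext_rep_br S1_even N_D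
    (S_lift _ (S1P a S1a)) (p_liftableZ N_Z _ e_lift)).
exists (rep_p_map p rho cext_rep_inv N); split.
- apply: (rep_partial_p_map char_p br_even_closed br_even_alt cext_rep_br S1_even
    cext_repK N_D N_Z lift) => a b S1a.
  have [_ _] := rep_p_map_liftable cext_repK lift S1a.
  (* [ev] reads the L-coordinate at (b, 0). Both parts of [N] give 0 there, because the map on S and
     the pair (e, y) satisfy the adjoint condition; so the new power of a acts on L as (ad a)^p. *)
  pose ev (M : cext_end L) : L := ((M : 'End(cext L)) (b, 0)).1.
  have evD M M' : ev (M + M') = ev M + ev M' by rewrite /ev add_lfunE.
  have evZ c M : ev (c *: M) = c *: ev M by rewrite /ev scale_lfunE.
  have ev_defect u v : br v b = iter p (br u) b -> ev (rho v - rho u ^+ p) = 0.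
    move=> uv; rewrite -scaleN1r evD evZ scaleN1r.
    by rewrite /ev cext_repE cext_rep_exp /= uv subrr.
  move/(congr1 ev); rewrite evD /N evD evZ !ev_defect //; last exact/pm_ad/S1P.
  by rewrite scaler0 !addr0 /ev cext_repE cext_rep_exp.
- by move=> a Sa; exact: (rep_p_mapE cext_repK (S_lift a Sa)).
- exact: (rep_p_mapE cext_repK e_lift).
Qed.
End QuasiFrobenius.

(** * The double extension *)

Section DoubleExtensionGrading.
Variables (K : fieldType) (V : vectType K) (V_ : bool -> {vspace V}).

Lemma dext_eq (u v : dext V) :
  u.1.1 = v.1.1 -> u.1.2 = v.1.2 -> u.2 = v.2 -> u = v.
Proof. by case: u v => [[s a] t] [[s' a'] t'] /= -> -> ->. Qed.

Lemma dext_decomp (u : dext V) : u = u.1.1 *: dx + dinj u.1.2 + u.2 *: dxs.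
Proof.
by apply: dext_eq => /=; rewrite ?scaler0 ?addr0 ?add0r //; exact: esym (mulr1 _).
Qed.

Lemma dgradingP i (u : dext V) :
  reflect [/\ u.1.2 \in V_ i, i -> u.1.1 = 0 & i -> u.2 = 0]
          (u \in dgrading V_ i).
Proof.
case: i; apply: (iffP idP) => /=.
- by move/memv_imgP => [a Va ->]; rewrite lfunE.
- case=> Va /(_ isT) s0 /(_ isT) t0; apply/memv_imgP; exists u.1.2 => //.
  by rewrite lfunE; apply: dext_eq.
- case/memv_addP => w /memv_addP[w1 /vlineP[s ->] [w2 /memv_imgP[a Va ->] ->]].
  move=> [w3 /vlineP[t ->] ->]; rewrite lfunE /=.
  by split=> //; rewrite !scaler0 add0r addr0.
case=> Va _ _; rewrite [u]dext_decomp.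
by rewrite !memv_add ?memvZ ?memv_line // -lfunE memv_img.
Qed.

Lemma dgrading_is_grading : is_grading V_ -> is_grading (dgrading V_).
Proof.
case=> full /directv_addP direct; split.
  apply/vspaceP => u; rewrite [RHS]memvf; apply: (introT idP).
  have : u.1.2 \in (V_ false + V_ true)%VS by rewrite full memvf.
  case/memv_addP => a0 V0 [a1 V1 ua]; apply/memv_addP.
  exists (u.1.1, a0, u.2); first by apply/dgradingP.
  exists (dinj a1); first by apply/dgradingP.
  by apply: dext_eq; rewrite /= ?addr0.
apply/directv_addP/eqP; rewrite -subv0; apply/subvP => u.
rewrite memv_cap => /andP[/dgradingP[V0 _ _] /dgradingP[V1 s0 t0]].
rewrite memv0; apply/eqP/dext_eq; rewrite ?s0 ?t0 //=.
by apply/eqP; rewrite -memv0 -direct memv_cap V0 V1.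
Qed.

End DoubleExtensionGrading.

(** * Bracket and form of the double extension *)

Section DoubleExtensionBracket.
Variables (K : fieldType) (V : vectType K) (V_ : bool -> {vspace V}).
Variables (br : {bilinear V -> V -> V}) (om : {biscalar V}) (D Ds : 'End(V)).
Variables (lam : K) (Z : V).

Fact Cform_is_bilinear : bilinear_for *%R *%R (Cform om D Ds).
Proof.
split=> [b c a a'|a c b b']; rewrite /Cform.
  by rewrite !linearP addrACA -scalerDr linearPl.
by rewrite linearPr.
Qed.

HB.instance Definition _ := bilinear_isBilinear.Build K V V K *%R *%R
  (Cform om D Ds) Cform_is_bilinear.

Let C := Cform om D Ds.

Definition dbr (u v : dext V) : dext V :=
  (C u.1.2 v.1.2 + u.2 * om Z v.1.2 - v.2 * om Z u.1.2
     + lam * (u.1.1 * v.2 - v.1.1 * u.2),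
   br u.1.2 v.1.2 + u.2 *: D v.1.2 - v.2 *: D u.1.2, 0).

Definition dom (u v : dext V) : K :=
  om u.1.2 v.1.2 + u.2 * v.1.1 - u.1.1 * v.2.

Let CDl x y z : C (x + y) z = C x z + C y z. Proof. exact: linearDl. Qed.
Let CNl x z : C (- x) z = - C x z. Proof. exact: linearNl. Qed.
Let CZl c x z : C (c *: x) z = c * C x z. Proof. exact: linearZl_LR. Qed.
Let CDr x y z : C z (x + y) = C z x + C z y. Proof. exact: linearDr. Qed.
Let CNr x z : C z (- x) = - C z x. Proof. exact: linearNr. Qed.
Let CZr c x z : C z (c *: x) = c * C z x. Proof. exact: linearZr_LR. Qed.
Let ODl x y z : om (x + y) z = om x z + om y z. Proof. exact: linearDl. Qed.
Let ONl x z : om (- x) z = - om x z. Proof. exact: linearNl. Qed.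
Let OZl c x z : om (c *: x) z = c * om x z. Proof. exact: linearZl_LR. Qed.
Let ODr x y z : om z (x + y) = om z x + om z y. Proof. exact: linearDr. Qed.
Let ONr x z : om z (- x) = - om z x. Proof. exact: linearNr. Qed.
Let OZr c x z : om z (c *: x) = c * om z x. Proof. exact: linearZr_LR. Qed.
Let BDl x y z : br (x + y) z = br x z + br y z. Proof. exact: linearDl. Qed.
Let BNl x z : br (- x) z = - br x z. Proof. exact: linearNl. Qed.
Let BZl c x z : br (c *: x) z = c *: br x z. Proof. exact: linearZl_LR. Qed.
Let BDr x y z : br z (x + y) = br z x + br z y. Proof. exact: linearDr. Qed.
Let BNr x z : br z (- x) = - br z x. Proof. exact: linearNr. Qed.
Let BZr c x z : br z (c *: x) = c *: br z x. Proof. exact: linearZr_LR. Qed.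
Let DD x y : D (x + y) = D x + D y. Proof. exact: linearD. Qed.
Let DN x : D (- x) = - D x. Proof. exact: linearN. Qed.
Let DZ c x : D (c *: x) = c *: D x. Proof. exact: linearZ. Qed.
Let ZK (c x : K) : c *: (x : K^o) = c * x. Proof. by []. Qed.
Let expand := (ZK, CDl, CNl, CZl, CDr, CNr, CZr, ODl, ONl, OZl, ODr, ONr, OZr,
  BDl, BNl, BZl, BDr, BNr, BZr, DD, DN, DZ).

Hypotheses (lie_a : is_lie_superalgebra V_ br)
  (qf_a : is_orthosymplectic_qf V_ br om).

(** Pairing with an arbitrary z turns identities between vectors into scalar ones, which [expand]
    and [ring] then settle. *)
Let om_inj x y : (forall z, om x z = om y z) -> x = y.
Proof.
have [[_ _ _ nd] _] := qf_a => xy; apply/eqP; rewrite -subr_eq0; apply/eqP/nd.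
by move=> z; rewrite ODl ONl xy subrr.
Qed.

Fact dbr_is_bilinear : bilinear_for *:%R *:%R dbr.
Proof.
split=> [w c u v|w c u v]; apply: dext_eq => /=.
- by rewrite !expand; ring.
- by apply: om_inj => z; rewrite !expand; ring.
- by rewrite scaler0 addr0.
- by rewrite !expand; ring.
- by apply: om_inj => z; rewrite !expand; ring.
- by rewrite scaler0 addr0.
Qed.

Fact dom_is_bilinear : bilinear_for *%R *%R dom.
Proof.
by split=> [w c u v|w c u v]; rewrite /dom /= !expand; ring.
Qed.

Hypotheses (der_D : is_derivation V_ br false D)
  (adjoint_D : is_adjoint V_ om false D Ds)
  (C_anti : antisymmetric_form V_ C) (C_closed : closed_form V_ br C)
  (Z_even : Z \in V_ false)
  (Z_Omega : forall a b, Omega om D Ds lam a b = om Z (br a b)).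

Let om_anti : antisymmetric_form V_ om. Proof. by have [[]] := qf_a. Qed.
Let om_closed : closed_form V_ br om. Proof. by have [[]] := qf_a. Qed.
Let D_even i a : a \in V_ i -> D a \in V_ i. Proof. by apply: der_D.1. Qed.

Lemma even_form_parity i j a b :
  a \in V_ i -> b \in V_ j -> i != j -> om a b = 0.
Proof.
have [_ om_even] := qf_a.
by case: i; case: j => // Va Vb _; [have [] := om_even b a | have [] := om_even a b].
Qed.

(** For an even form only arguments of equal parity pair nontrivially, so the sign depends on a
    alone and b may be arbitrary. *)
Lemma antisymmetric_even_form i a b :
  a \in V_ i -> om b a = - ((-1) ^+ i * om a b).
Proof.
move=> Va; elim/(homogeneous_ind lie_a): b => [j b Vb|b c IHb IHc]; last first.
  by rewrite !expand IHb IHc; ring.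
have [ji|ji] := eqVneq j i.
  by rewrite (om_anti Vb Va) /koszul ji andbb.
rewrite (even_form_parity Vb Va ji) (even_form_parity Va Vb) 1?eq_sym //.
by rewrite mulr0 oppr0.
Qed.

Lemma adjointE a b : om (D a) b = om a (Ds b).
Proof.
elim/(homogeneous_ind lie_a): a => [i a Va|a c IHa IHc].
  by rewrite (adjoint_D b Va) /koszul andbF mul1r.
by rewrite !expand IHa IHc.
Qed.

(** Exchanging the arguments twice produces the same sign both times, as D preserves parity. *)
Lemma adjoint_sym a b : om (Ds a) b = om a (D b).
Proof.
elim/(homogeneous_ind lie_a): b => [i b Vb|b c IHb IHc].
  rewrite (antisymmetric_even_form _ Vb) -adjointE.
  by rewrite [RHS](antisymmetric_even_form _ (D_even Vb)).
by rewrite !expand IHb IHc.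
Qed.

Lemma CformE a b : C a b = om (D a) b + om a (D b).
Proof. by rewrite /C /Cform ODl adjoint_sym. Qed.

Lemma Cform_parity i j a b : a \in V_ i -> b \in V_ j -> i != j -> C a b = 0.
Proof.
move=> Va Vb ij; rewrite CformE (even_form_parity (D_even Va) Vb ij).
by rewrite (even_form_parity Va (D_even Vb) ij) addr0.
Qed.

(** This is the x-coordinate of the Jacobi identity for xs, a, b in the double extension; the lambda
    term comes from [xs, x] = - lambda x. *)
Lemma Omega_Cform a b :
  om Z (br a b) = C (D a) b + C a (D b) + lam * C a b.
Proof.
rewrite -Z_Omega /Omega mulr2n !CformE !expand /= !adjoint_sym.
ring.
Qed.

(** The cocycle identity is rearranged so that it matches the Jacobi identity term by term. *)
Lemma closed_form_jacobi (f : {biscalar V}) i j k a b c :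
  antisymmetric_form V_ f -> closed_form V_ br f ->
  a \in V_ i -> b \in V_ j -> c \in V_ k ->
  f a (br b c) = f (br a b) c + koszul K i j * f b (br a c).
Proof.
move=> f_anti f_closed Va Vb Vc; have [_ _ cl anti _] := lie_a.
have := f_closed i j k a b c Va Vb Vc.
rewrite (f_anti _ _ _ _ Vc (cl _ _ _ _ Va Vb)) (anti _ _ _ _ Vc Va).
rewrite linearNr linearZr_LR /= /koszul.
case: i j k {Va Vb Vc} => [] [] [] /=; rewrite ?expr0 ?expr1 => H; apply/eqP;
  rewrite -subr_eq0; apply/eqP;
  first [by rewrite -[RHS]H; ring | by rewrite -oppr0 -[in RHS]H; ring].
Qed.

Lemma D_br i a b : a \in V_ i -> D (br a b) = br (D a) b + br a (D b).
Proof. by move=> Va; rewrite (proj2 der_D _ _ _ Va) /koszul expr0 scale1r. Qed.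

Lemma dbr_grading i j u v : u \in dgrading V_ i -> v \in dgrading V_ j ->
  dbr u v \in dgrading V_ (i (+) j).
Proof.
have [_ _ cl _ _] := lie_a.
move=> /dgradingP[Vu su tu] /dgradingP[Vv sv tv]; apply/dgradingP; split=> //=.
  apply: memvB; first apply: memvD; first exact: cl.
    case: i Vu su tu => Vu su tu; first by rewrite tu ?scale0r ?mem0v.
    by rewrite memvZ // D_even.
  case: j Vv sv tv => Vv sv tv; first by rewrite tv ?scale0r ?mem0v.
  by rewrite addbF memvZ // D_even.
move=> ij; rewrite (Cform_parity Vu Vv); last first.
  by case: i j ij {Vu su tu Vv sv tv} => [] [].
case: i j ij Vu su tu Vv sv tv => [] [] // _ Vu su tu Vv sv tv.
  rewrite tu // su // (even_form_parity Z_even Vu) //; ring.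
rewrite tv // sv // (even_form_parity Z_even Vv) //; ring.
Qed.

Lemma dbr_antisymmetric i j u v : u \in dgrading V_ i -> v \in dgrading V_ j ->
  dbr u v = - (koszul K i j *: dbr v u).
Proof.
have [_ _ _ anti _] := lie_a.
move=> /dgradingP[Vu su tu] /dgradingP[Vv sv tv]; apply: dext_eq => /=.
- rewrite (C_anti Vu Vv) /koszul.
  case: i j Vu su tu Vv sv tv => [] [] Vu su tu Vv sv tv;
    try rewrite (su isT); try rewrite (tu isT); try rewrite (sv isT);
    try rewrite (tv isT);
    rewrite /= ZK ?expr0 ?expr1; ring.
- apply: om_inj => z; rewrite (anti _ _ _ _ Vu Vv) /koszul.
  case: i j Vu su tu Vv sv tv => [] [] Vu su tu Vv sv tv;
    try rewrite (su isT); try rewrite (tu isT); try rewrite (sv isT);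
    try rewrite (tv isT);
    rewrite /= !expand ?expr0 ?expr1; ring.
- by rewrite scaler0 oppr0.
Qed.

(** In the x-coordinate the identity combines closedness of C, when all entries lie in V, with
    [Omega_Cform], when one is xs. In the V-coordinate it is the Jacobi identity of [br] together
    with the Leibniz rule for D. *)
Lemma dbr_jacobi i j k u v w :
  u \in dgrading V_ i -> v \in dgrading V_ j -> w \in dgrading V_ k ->
  dbr u (dbr v w) = dbr (dbr u v) w + koszul K i j *: dbr v (dbr u w).
Proof.
have [_ _ _ anti [jac _]] := lie_a.
move=> /dgradingP[Vu su tu] /dgradingP[Vv sv tv] /dgradingP[Vw sw tw].
apply: dext_eq => /=; last by rewrite scaler0 addr0.
- rewrite !expand !Omega_Cform.
  have C_jac : C u.1.2 (br v.1.2 w.1.2) = C (br u.1.2 v.1.2) w.1.2 +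
      koszul K i j * C v.1.2 (br u.1.2 w.1.2).
    exact: closed_form_jacobi Vu Vv Vw.
  rewrite C_jac (C_anti Vv (D_even Vu)) /koszul.
  case: i j k Vu su tu Vv sv tv Vw sw tw {C_jac} =>
    [] [] [] Vu su tu Vv sv tv Vw sw tw;
    try rewrite (su isT); try rewrite (tu isT); try rewrite (sv isT);
    try rewrite (tv isT); try rewrite (sw isT); try rewrite (tw isT);
    rewrite /= ?expr0 ?expr1; ring.
- apply: om_inj => z.
  rewrite !expand (D_br _ Vv) (D_br _ Vu) (jac _ _ _ _ _ _ Vu Vv Vw).
  rewrite (D_br _ Vu) (anti _ _ _ _ Vv (D_even Vu)) /koszul.
  case: i j k Vu su tu Vv sv tv Vw sw tw => [] [] [] Vu su tu Vv sv tv Vw sw tw;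
    try rewrite (su isT); try rewrite (tu isT); try rewrite (sv isT);
    try rewrite (tv isT);
    try rewrite (sw isT); try rewrite (tw isT);
    rewrite /= !expand ?expr0 ?expr1; ring.
Qed.

Lemma dbr_is_lie_superalgebra : is_lie_superalgebra (dgrading V_) dbr.
Proof.
have [gr _ cl _ [_ cube]] := lie_a; split; last split.
- exact: dgrading_is_grading.
- exact: dbr_is_bilinear.
- exact: dbr_grading.
- exact: dbr_antisymmetric.
- exact: dbr_jacobi.
move=> u /dgradingP[Vu /(_ isT) su /(_ isT) tu].
have Vuu := cl true true _ _ Vu Vu.
apply: dext_eq => //=; rewrite tu.
  (* C is even, while u is odd and [u, u] is even. *)
  by rewrite !expand (Cform_parity Vu Vuu) //; ring.
by rewrite !(scale0r, subr0, addr0) cube.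
Qed.

(** Closedness on xs, a, b amounts to C(a, b) = om(D a, b) + om(a, D b), as pairing xs with [a, b]
    gives the x-coordinate of the bracket. For nondegeneracy, pairing with [dxs], [dinj b] and [dx]
    detects the three coordinates. *)
Lemma dom_is_orthosymplectic_qf :
  is_orthosymplectic_qf (dgrading V_) dbr dom.
Proof.
have [[_ _ _ nd] om_even] := qf_a; have [_ _ _ anti _] := lie_a; split; first split.
- exact: dom_is_bilinear.
- move=> i j u v /dgradingP[Vu su tu] /dgradingP[Vv sv tv].
  rewrite /dom (om_anti Vu Vv) /koszul.
  case: i j Vu su tu Vv sv tv => [] [] Vu su tu Vv sv tv;
    try rewrite (su isT); try rewrite (tu isT); try rewrite (sv isT);
    try rewrite (tv isT); rewrite /= ?expr0 ?expr1; ring.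
- move=> i j k u v w /dgradingP[Vu su tu] /dgradingP[Vv sv tv] /dgradingP[Vw sw tw].
  rewrite /dom /= !expand.
  have := om_closed Vu Vv Vw.
  rewrite !CformE (om_anti Vw (D_even Vu)) (om_anti (D_even Vw) Vu).
  rewrite (om_anti Vv (D_even Vu)) (om_anti Vw (D_even Vv)) /koszul.
  case: i j k Vu su tu Vv sv tv Vw sw tw =>
    [] [] [] Vu su tu Vv sv tv Vw sw tw;
    try rewrite (su isT); try rewrite (tu isT); try rewrite (sv isT);
    try rewrite (tv isT); try rewrite (sw isT); try rewrite (tw isT);
    rewrite /= ?expr0 ?expr1 => om_jac; rewrite -[RHS]om_jac; ring.
- move=> u u0; apply: dext_eq => /=.
  + have := u0 dxs; rewrite /dom /= linear0r => /eqP.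
    by rewrite mulr0 mulr1 addr0 sub0r oppr_eq0 => /eqP.
  + by apply: nd => b; have := u0 (dinj b); rewrite /dom /= !mulr0 addr0 subr0.
  + by have := u0 dx; rewrite /dom /= linear0r mulr0 mulr1 subr0 add0r.
move=> u v /dgradingP[Vu _ _] /dgradingP[Vv /(_ isT) sv /(_ isT) tv].
have [om1 om2] := om_even _ _ Vu Vv.
by rewrite /dom om1 om2 sv tv; split; ring.
Qed.
End DoubleExtensionBracket.

(** * The p|2p-map on the double extension *)

Section DextCoordinates.
Variables (K : fieldType) (V : vectType K).

Definition dcoord_x (u : dext V) : K := u.1.1.
Definition dcoord_xs (u : dext V) : K := u.2.

Fact dcoord_x_is_scalar : scalar dcoord_x. Proof. by []. Qed.
Fact dcoord_xs_is_scalar : scalar dcoord_xs. Proof. by []. Qed.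

HB.instance Definition _ :=
  GRing.isLinear.Build K (dext V) K _ dcoord_x dcoord_x_is_scalar.
HB.instance Definition _ :=
  GRing.isLinear.Build K (dext V) K _ dcoord_xs dcoord_xs_is_scalar.

End DextCoordinates.

Lemma dext_sum (K : fieldType) (V : vectType K) (I : Type) (r : seq I)
    (t : I -> K) (s : I -> V) :
  \sum_(i <- r) ((t i, s i, 0) : dext V) =
    (\sum_(i <- r) t i, \sum_(i <- r) s i, 0).
Proof.
elim/big_rec3: _ => // i x y _ _ ->; apply: dext_eq => //=; exact: addr0.
Qed.

Definition bilinear_of (K : fieldType) (V W : vectType K) (f : V -> V -> W)
    (f_bilin : bilinear_for *:%R *:%R f) : {bilinear V -> V -> W} :=
  HB.pack f (bilinear_isBilinear.Build K V V W *:%R *:%R f f_bilin).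

Definition biscalar_of (K : fieldType) (V : vectType K) (f : V -> V -> K)
    (f_bilin : bilinear_for *%R *%R f) : {biscalar V} :=
  HB.pack f (bilinear_isBilinear.Build K V V K *%R *%R f f_bilin).

Section DoubleExtensionPMap.
Variables (K : fieldType) (p : nat).
Hypotheses (char_p : p \in [pchar K]) (p_gt2 : (2 < p)%N).
Variables (V : vectType K) (V_ : bool -> {vspace V}).
Variables (br : {bilinear V -> V -> V}) (om : {biscalar V}).
Variables (D Ds : 'End(V)) (lam : K) (Z : V) (pm : V -> V) (P : V -> K).
Hypotheses (lie_a : is_lie_superalgebra V_ br)
  (pm_a : is_p2p_map p V_ br pm)
  (qf_a : is_orthosymplectic_qf V_ br om)
  (der_D : is_derivation V_ br false D)
  (restricted_D : restricted_derivation p V_ br pm D)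
  (adjoint_D : is_adjoint V_ om false D Ds)
  (P_map : is_Pmap p V_ br om D Ds P)
  (C_anti : antisymmetric_form V_ (Cform om D Ds))
  (C_closed : closed_form V_ br (Cform om D Ds))
  (C_pm : forall a b, a \in V_ false -> b \in V_ false ->
     Cform om D Ds a (pm b) - Cform om D Ds (iter p.-1 (br^~ b) a) b = 0)
  (Z_even : Z \in V_ false)
  (Z_Omega : forall a b, Omega om D Ds lam a b = om Z (br a b))
  (Z_T : forall a, a \in V_ false -> Tmap p br om D Ds lam P a = om Z (pm a)).

Let C := Cform om D Ds.
Let B := dbr br om D Ds lam Z.
Let L_ := dgrading V_.

Let p_gt0 : (0 < p)%N. Proof. exact: prime_gt0 (pcharf_prime char_p). Qed.
Let p1E : p.-1 = p.-2.+1.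
Proof. by case: p p_gt2 => [|[]]. Qed.
Let pE : p = p.-2.+2. Proof. by rewrite -p1E prednK. Qed.

Lemma iter_br_linear n a c x y :
  iter n (br a) (c *: x + y) = c *: iter n (br a) x + iter n (br a) y.
Proof. by elim: n => //= n ->; rewrite linearPr. Qed.

(** Once the xs-coordinate is 0, D no longer enters; and since [dinj a] kills x, only the last
    application of C remains. *)
Lemma iter_dbr_dinj n a (w : dext V) : w.2 = 0 ->
  iter n.+1 (B (dinj a)) w =
    (C a (iter n (br a) w.1.2), iter n.+1 (br a) w.1.2, 0).
Proof.
move=> w0; elim: n => [|n IHn].
  apply: dext_eq => //=; rewrite w0 ?scale0r ?addr0 ?subr0 //; ring.
rewrite iterS IHn; apply: dext_eq => //=; rewrite ?scale0r ?addr0 ?subr0 //; ring.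
Qed.

(** The cocycle condition on C and [pm] with its arguments exchanged. For z even, passing from right
    to left brackets costs (-1)^(p-1) = 1; for z odd both sides vanish because C is even. *)
Lemma Cform_pm a z : a \in V_ false -> C (pm a) z = C a (iter p.-1 (br a) z).
Proof.
move=> Va; have [[pmV _ _ _] _] := pm_a; have [_ _ cl anti _] := lie_a.
have iter_parity n i b : b \in V_ i -> iter n (br a) b \in V_ i.
  by move=> Vb; elim: n => //= n; apply: (cl false i).
elim/(homogeneous_ind lie_a): z => [[] z Vz|y z IHy IHz].
- have par := Cform_parity lie_a qf_a der_D adjoint_D _ _ (isT : false != true).
  by rewrite /C (par _ _ (pmV a Va) Vz) (par _ _ Va (iter_parity p.-1 true z Vz)).
- have sign n : iter n (br^~ a) z = (-1) ^+ n *: iter n (br a) z.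
    elim: n => [|n /= ->]; first by rewrite scale1r.
    rewrite linearZl_LR /= (anti false false) ?iter_parity //.
    by rewrite scale1r exprS mulN1r scaleNr scalerN.
  have := C_pm Vz Va; rewrite sign -signr_odd.
  rewrite (negbTE (even_pred_pchar char_p p_gt2)).
  rewrite scale1r => /eqP; rewrite subr_eq0 => /eqP C_eq.
  rewrite /C (C_anti (pmV a Va) Vz) C_eq.
  rewrite (C_anti (iter_parity p.-1 false z Vz) Va).
  by rewrite /koszul expr0 !mul1r opprK.
- rewrite -[y]scale1r iter_br_linear /C !linearPr /= -/C.
  by rewrite IHy IHz.
Qed.

Definition dext_p_map0 (u : dext V) : dext V := (P u.1.2, pm u.1.2, 0).

(** On xs the x-coordinate is the condition on T, and the V-coordinate says that D is restricted; on
    V the x-coordinate is [Cform_pm]. *)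
Lemma dext_p_map0_ad a w : a \in V_ false ->
  B (dext_p_map0 (dinj a)) w = iter p (B (dinj a)) w.
Proof.
move=> Va; have [[pmV _ _ _] pm_ad] := pm_a.
have Zpm : om Z (pm a) = C a (iter p.-2 (br a) (D a)) + lam * P a.
  by rewrite -Z_T.
have it n x y c :
    iter n (br a) (x - c *: y) = iter n (br a) x - c *: iter n (br a) y.
  by rewrite [x - _]addrC -!scaleNr iter_br_linear addrC.
(* The first bracket removes the xs-coordinate, after which [iter_dbr_dinj] computes the other p -
   1. *)
rewrite [in RHS]pE iterSr iter_dbr_dinj //= scale0r addr0.
apply: dext_eq => //=.
  rewrite -/C it -iterSr -p1E (Cform_pm _ Va) Zpm /C linearBr linearZr_LR /=; ring.
rewrite scale0r addr0 pm_ad // restricted_D // it p1E /=.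
by rewrite linearBr linearZr_LR /= -iterSr [in LHS]pE.
Qed.

Lemma dext_p_map0_partial :
  partial_p_map p (L_ false) (linfun (@dinj K V) @: V_ false) B dext_p_map0.
Proof.
have [[pmV _ pmZ pmD] _] := pm_a; have [PZ PD] := P_map.
split=> [_ /memv_imgP[a Va ->]|_ w /memv_imgP[a Va ->]|c _ /memv_imgP[a Va ->]|
         _ _ /memv_imgP[a Va ->] /memv_imgP[b Vb ->]]; rewrite ?lfunE /=.
- by apply/(@dgradingP _ _ V_ false); split=> //=; apply: pmV.
- exact: dext_p_map0_ad.
- by apply: dext_eq => /=; rewrite ?PZ ?pmZ ?scaler0.
have [s s_terms pm_ab] := pmD a b Va Vb.
have [t t_terms P_ab] := PD a b Va Vb.
(* Jacobson terms in the double extension: those of [br] in the V-coordinate and the sigma_i from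
   the condition on P in the x-coordinate. *)
exists (fun i => (t i, s i, 0)) => [mu|].
  rewrite -linearP [in LHS]p1E iter_dbr_dinj // -p1E /= s_terms.
  rewrite [C _ _]t_terms -dext_sum; apply: eq_bigr => i _; apply: dext_eq => //=.
    by rewrite mulrAC.
  by rewrite scaler0.
rewrite dext_sum /dext_p_map0; apply: dext_eq => //=.
by rewrite !addr0.
Qed.

Lemma dbr_dxs (w : dext V) : B dxs w = (om Z w.1.2 - lam * w.1.1, D w.1.2, 0).
Proof.
apply: dext_eq => //=; last first.
  by rewrite [D 0]linear0 [br 0 _]linear0l add0r scale1r scaler0 subr0.
rewrite [Cform _ _ _ _ _]linear0l [om Z 0]linear0r; ring.
Qed.

(** x is an eigenvector of ad(xs) for - lambda, so each contribution om(Z, D^j w) to the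
    x-coordinate is multiplied by - lambda at every later step. *)
Lemma iter_dbr_dxs n (w : dext V) :
  iter n.+1 (B dxs) w =
    (\sum_(j < n.+1) (- lam) ^+ (n - j) * om Z (iter j D w.1.2)
       + (- lam) ^+ n.+1 * w.1.1, iter n.+1 D w.1.2, 0).
Proof.
elim: n => [|n IHn].
  by rewrite /= dbr_dxs big_ord1 expr0 expr1 mul1r mulNr.
rewrite iterS IHn dbr_dxs; apply: dext_eq => //=.
rewrite [in RHS]big_ord_recr /= subnn expr0 mul1r.
under [in RHS]eq_bigr => i _ do rewrite subSn -1?ltnS // exprS -mulrA.
rewrite -mulr_sumr [(- lam) ^+ n.+2]exprS; ring.
Qed.

Lemma dbr_dx (w : dext V) : B dx w = (lam * w.2, 0, 0).
Proof.
apply: dext_eq => //=; last first.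
  by rewrite [D 0]linear0 [br 0 _]linear0l scaler0 scale0r subr0 addr0.
rewrite [Cform _ _ _ _ _]linear0l [om Z 0]linear0r; ring.
Qed.

Lemma iter_dbr_dx (w : dext V) : iter p (B dx) w = 0.
Proof.
rewrite pE !iterSr !dbr_dx /= mulr0.
by elim: p.-2 => //= n ->; rewrite dbr_dx /= mulr0.
Qed.

(** The three cases in one form free of division by lambda. The conditions on a0, gamma, lamt say
    that ad(xs)^p is the adjoint map of the prescribed power of xs; those on b0, sigma, delta say
    that the prescribed power of x is central. *)
Theorem double_extension_p_map (gamma lamt sigma delta : K) (a0 b0 : V) :
  a0 \in V_ false -> b0 \in V_ false ->
  (forall a, iter p D a = gamma *: D a + br a0 a) ->
  D a0 = 0 -> om Z a0 = lam * lamt -> lam ^+ p = lam * gamma ->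
  Ds a0 + gamma *: Z = \sum_(j < p) (- lam) ^+ (p.-1 - j) *: iter j Ds Z ->
  D b0 = 0 -> om Z b0 = lam * sigma -> lam * delta = 0 ->
  Ds b0 = - (delta *: Z) -> (forall a, br b0 a = - (delta *: D a)) ->
  exists pmG : dext V -> dext V,
    is_p2p_map p L_ B pmG /\
    [/\ forall a, a \in V_ false -> pmG (dinj a) = dinj (pm a) + P a *: dx,
        pmG dxs = gamma *: dxs + dinj a0 + lamt *: dx
      & pmG dx = dinj b0 + sigma *: dx + delta *: dxs].
Proof.
move=> Va0 Vb0 D_p Da0 Za0 lam_p Dsa0 Db0 Zb0 lam_delta Dsb0 br_b0.
have adj_sym := adjoint_sym lie_a qf_a der_D adjoint_D.
have om_iter j z : om (iter j Ds Z) z = om Z (iter j D z).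
  by elim: j z => //= j IHj z; rewrite adj_sym IHj -iterS iterSr.
pose S0 := (linfun (@dinj K V) @: V_ false)%VS.
pose y : dext V := dinj b0 + sigma *: dx + delta *: dxs.
pose ys : dext V := gamma *: dxs + dinj a0 + lamt *: dx.
have yE : y = (sigma, b0, delta).
  by apply: dext_eq => /=; rewrite ?scaler0 ?addr0 ?add0r //; exact: mulr1.
have ysE : ys = (lamt, a0, gamma).
  by apply: dext_eq => /=; rewrite ?scaler0 ?addr0 ?add0r //; exact: mulr1.
(* As ad(x)^p = 0, y has to be central: Ds b0 = - delta Z cancels the Z term on V, om(Z, b0) =
   lambda sigma handles xs, and lambda delta = 0 handles x. *)
have y_ad w : B y w = iter p (B dx) w.
  rewrite iter_dbr_dx yE; apply: dext_eq => //=.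
    rewrite /Cform Db0 add0r Dsb0 Zb0 linearNl linearZl_LR /=.
    transitivity (- (lam * delta) * w.1.1); first by ring.
    by rewrite lam_delta oppr0 mul0r.
  by rewrite br_b0 Db0 scaler0 subr0 addNr.
have odd_p : odd p.
  by rewrite -(prednK p_gt0) /= (even_pred_pchar char_p).
have ys_ad w : B ys w = iter p (B dxs) w.
  rewrite -[p in RHS](prednK p_gt0) iter_dbr_dxs ysE; apply: dext_eq => /=.
  (* In the x-coordinate, x requires lambda^p = lambda gamma (p is odd), xs requires om(Z, a0) =
     lambda lamt, and V requires the formula for Ds a0 + gamma Z, moved across [om]. *)
  - rewrite (prednK p_gt0) exprNn -signr_odd odd_p lam_p expr1 Za0.
    have -> : \sum_(j < p) (- lam) ^+ (p.-1 - j) * om Z (iter j D w.1.2) =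
        om (Ds a0 + gamma *: Z) w.1.2.
      rewrite Dsa0 (linear_sumlz) /=.
      by apply: eq_bigr => j _; rewrite linearZl_LR /= om_iter.
    rewrite /Cform Da0 add0r linearDl linearZl_LR /=; ring.
  - by rewrite -iterS (prednK p_gt0) D_p Da0 scaler0 subr0 addrC.
  - by [].
pose brG := bilinear_of (dbr_is_bilinear D Ds lam Z qf_a).
have lieG : is_lie_superalgebra L_ brG.
  exact: dbr_is_lie_superalgebra.
have qfG : is_orthosymplectic_qf L_ brG (biscalar_of (dom_is_bilinear om)).
  exact: dom_is_orthosymplectic_qf.
have L_dx : dx \in L_ false.
  by apply/(@dgradingP _ _ V_ false); split; rewrite /= ?mem0v.
have L_dxs : dxs \in L_ false.
  by apply/(@dgradingP _ _ V_ false); split; rewrite /= ?mem0v.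
have L_y : y \in L_ false by rewrite yE; apply/(@dgradingP _ _ V_ false); split.
have L_ys : ys \in L_ false by rewrite ysE; apply/(@dgradingP _ _ V_ false); split.
have S0_even : (S0 <= L_ false)%VS.
  apply/subvP => _ /memv_imgP[a Va ->]; rewrite lfunE.
  by apply/(@dgradingP _ _ V_ false); split.
(* x and then xs are adjoined to the even part of V; the coordinate functional of the new vector
   serves as [tau]. *)
have [||pm1 [pm1_partial pm1_S0 pm1_dx]] :=
  partial_p_map_extend char_p lieG qfG p_gt2 (tau := @dcoord_x K V) S0_even
    dext_p_map0_partial L_dx L_y y_ad.
- by move=> _ /memv_imgP[a _ ->]; rewrite lfunE.
- by [].
have S1_even : (S0 + <[dx]> <= L_ false)%VS by rewrite subv_add S0_even -memvE.
have [||pmG [pmG_partial pmG_S1 pmG_dxs]] :=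
  partial_p_map_extend char_p lieG qfG p_gt2 (tau := @dcoord_xs K V) S1_even
    pm1_partial L_dxs L_ys ys_ad.
- move=> _ /memv_addP[_ /memv_imgP[a _ ->] [_ /vlineP[c ->] ->]].
  by rewrite lfunE /= /dcoord_xs /= scaler0 addr0.
- by [].
exists pmG; split.
  have evenE : L_ false = (S0 + <[dx]> + <[dxs]>)%VS.
    by rewrite /L_ /dgrading [(<[dx]> + _)%VS]addvC.
  move: pmG_partial; rewrite -evenE => -[pmG_even pmG_ad pmG_scale pmG_add].
  by split=> //; split=> // a b Va _; apply: pmG_ad.
split=> [a Va|//|].
  have S0a : dinj a \in S0 by rewrite -(lfunE (@dinj K V)) memv_img.
  rewrite pmG_S1 ?(subvP (addvSl _ _)) // pm1_S0 //.
  by apply: dext_eq => /=; rewrite ?scaler0 ?addr0 ?add0r //; exact/esym/mulr1.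
by rewrite pmG_S1 // (subvP (addvSr _ _)) ?memv_line.
Qed.

End DoubleExtensionPMap.

(** * Reduction of the three cases to one set of conditions *)

Lemma sum_exprN0 (K : fieldType) (V : lmodType K) (n : nat) (v : nat -> V) :
  \sum_(j < n.+1) (- (0 : K)) ^+ (n - j) *: v j = v n.
Proof.
rewrite big_ord_recr /= subnn expr0 scale1r big1 ?add0r // => j _.
by rewrite oppr0 expr0n subn_eq0 leqNgt ltn_ord scale0r.
Qed.

Theorem theorem3p1 (K : fieldType) (p : nat)
  (char_p : p \in [pchar K]) (p_gt2 : (2 < p)%N)
  (V : vectType K) (V_ : bool -> {vspace V})
  (br : V -> V -> V) (pm : V -> V) (om : V -> V -> K)
  (lie_a : is_lie_superalgebra V_ br)
  (restricted_a : is_p2p_map p V_ br pm)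
  (qf_a : is_orthosymplectic_qf V_ br om)
  (D Ds : 'End(V))
  (der_D : is_derivation V_ br false D)
  (restricted_D : restricted_derivation p V_ br pm D)
  (adjoint_D : is_adjoint V_ om false D Ds)
  (gamma : K) (a0 : V)
  (p_property_D : p_property p V_ br D gamma a0)
  (lam : K) (P : V -> K)
  (P_map : is_Pmap p V_ br om D Ds P)
  (T_star : star_property p V_ br (Omega om D Ds lam) (Tmap p br om D Ds lam P))
  (OmegaT_B2 :
     in_B2 p V_ br pm (Omega om D Ds lam) (Tmap p br om D Ds lam P))
  (CP_Z2 : in_Z2 p V_ br pm (Cform om D Ds) P)
  (Z : V) (Z_even : Z \in V_ false)
  (Z_Omega : forall a b, Omega om D Ds lam a b = om Z (br a b))
  (Z_T : forall a, a \in V_ false -> Tmap p br om D Ds lam P a = om Z (pm a)) :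
  exists (brG : dext V -> dext V -> dext V) (omG : dext V -> dext V -> K),
    [/\
      (* (i) *)
      is_lie_superalgebra (dgrading V_) brG /\
      [/\ brG dx dxs = lam *: dx,
          (forall a b, brG (dinj a) (dinj b) =
             dinj (br a b) + om (D a + Ds a) b *: dx),
          (forall a, brG dxs (dinj a) = dinj (D a) + om Z a *: dx)
        & (forall a, brG dx (dinj a) = 0)],
      is_orthosymplectic_qf (dgrading V_) brG omG /\
      [/\ (forall a b, omG (dinj a) (dinj b) = om a b),
          (forall a, omG (dinj a) dx = 0 /\ omG (dinj a) dxs = 0),
          omG dxs dx = 1
        & omG dx dx = 0 /\ omG dxs dxs = 0]
      (* (ii) *)
    & forall (b0 : V) (lamt sigma delta : K), b0 \in V_ false ->
      [\/ (* (a) *)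
          lam != 0 /\
          [/\ D a0 = 0 /\ lamt = lam^-1 * om Z a0,
              gamma = lam ^+ p.-1 /\ delta = 0,
              D b0 = 0 /\ sigma = lam^-1 * om Z b0,
              Ds b0 = 0 /\ in_center br b0
            & Ds a0 = \sum_(1 <= i < p)
                 ((-1) ^+ (p - 1 - i) * lam ^+ (p - 1 - i)) *: iter i Ds Z],
          (* (b) *)
          [/\ lam = 0,
              ~ (exists (d : K) (c : V),
                   [/\ d != 0, c \in V_ false
                     & forall a, D a = - (d^-1 *: br c a)])
            & [/\ D a0 = 0 /\ om Z a0 = 0,
                  delta = 0,
                  D b0 = 0 /\ om Z b0 = 0,
                  Ds b0 = 0 /\ in_center br b0
                & Ds a0 + gamma *: Z = iter p.-1 Ds Z]]
        | (* (c) *)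
          [/\ lam = 0,
              delta != 0 /\ (forall a, D a = - (delta^-1 *: br b0 a))
            & [/\ D a0 = 0 /\ om Z a0 = 0,
                  D b0 = 0 /\ om Z b0 = 0,
                  Ds b0 = - (delta *: Z)
                & Ds a0 + gamma *: Z = iter p.-1 Ds Z]]] ->
      exists pmG : dext V -> dext V,
        is_p2p_map p (dgrading V_) brG pmG /\
        [/\ (forall a, a \in V_ false -> pmG (dinj a) = dinj (pm a) + P a *: dx),
            pmG dxs = gamma *: dxs + dinj a0 + lamt *: dx
          & pmG dx = dinj b0 + sigma *: dx + delta *: dxs]].
Proof.
have [_ br_bilin _ _ _] := lie_a; have [[om_bilin _ _ _] _] := qf_a.
have [[_ C_anti _] C_closed C_pm] := CP_Z2.
have [Va0 D_p Da0] := p_property_D.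
pose br' := bilinear_of br_bilin; pose om' := biscalar_of om_bilin.
exists (dbr br' om' D Ds lam Z), (dom om').
have pK := prednK (prime_gt0 (pcharf_prime char_p)).
have om0l x : om 0 x = 0 by exact: (linear0l om').
have om0r x : om x 0 = 0 by exact: (linear0r om').
have p_map gam := double_extension_p_map char_p p_gt2 (br := br') (om := om')
  lie_a restricted_a qf_a der_D restricted_D adjoint_D P_map C_anti C_closed
  C_pm Z_even Z_Omega Z_T (gamma := gam).
split.
- split; first exact: dbr_is_lie_superalgebra.
  split=> [|a b|a|a]; rewrite ?dbr_dx ?dbr_dxs; apply: dext_eq => /=;
    rewrite ?scaler0 ?scale0r ?addr0 ?add0r ?subr0 //.
  + by rewrite !(mul0r, subr0, mulr0, addr0); exact/esym/mulr1.
  + by rewrite mulr0 subr0; exact/esym/mulr1.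
  + by rewrite mulr0.
- split; first exact: dom_is_orthosymplectic_qf.
  rewrite /dom /=; split=> [a b|a||].
  + by ring.
  + by rewrite om0r; split; ring.
  + by rewrite om0l; ring.
  + by rewrite om0l; split; ring.
move=> b0 lamt sigma delta Vb0.
case=> [[lam_neq0 [[_ lamtE] [gammaE deltaE] [Db0 sigmaE] [Dsb0 b0_central] Dsa0]]|
        [lam0 _ [[_ Za0] deltaE [Db0 Zb0] [Dsb0 b0_central] Dsa0]]|
        [lam0 [delta_neq0 D_inner] [[_ Za0] [Db0 Zb0] Dsb0 Dsa0]]].
- apply: p_map => //.
  + by rewrite lamtE mulVKf.
  + by rewrite gammaE -exprS pK.
  + rewrite Dsa0 gammaE.
    (* The term j = 0 is (- lambda)^(p-1) Z = gamma Z, as p - 1 is even; it matches gamma Z on the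
       left, and the rest is the formula of case (a). *)
    rewrite -(big_mkord xpredT (fun j => (- lam) ^+ (p.-1 - j) *: iter j Ds Z)).
    rewrite [RHS]big_ltn ?prime_gt0 ?(pcharf_prime char_p) // subn0 addrC.
    congr (_ + _); first
      by rewrite exprNn -signr_odd (negbTE (even_pred_pchar char_p p_gt2)) mul1r.
    by apply: eq_big_nat => i _; rewrite [in RHS]exprNn subn1.
  + by rewrite sigmaE mulVKf.
  + by rewrite deltaE mulr0.
  + by rewrite deltaE scale0r oppr0.
  + by move=> a; rewrite deltaE scale0r oppr0; apply: b0_central.
- apply: p_map => //; rewrite ?lam0 ?mul0r //.
  + by rewrite -pK expr0n.
  (* At lambda = 0 the convention 0^0 = 1 leaves only the term j = p - 1. *)
  + by rewrite Dsa0 -[in RHS]pK sum_exprN0.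
  + by rewrite deltaE scale0r oppr0.
  + by move=> a; rewrite deltaE scale0r oppr0; apply: b0_central.
- apply: p_map => //; rewrite ?lam0 ?mul0r //.
  + by rewrite -pK expr0n.
  + by rewrite Dsa0 -[in RHS]pK sum_exprN0.
  + by move=> a; rewrite D_inner scalerN opprK scalerA mulfV // scale1r.
Qed.
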